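(* Let $m$ and $n$ be positive integers, and suppose that $m = 2^k + 1$ for some positive integer $k$. Then the exponent of $2$ in the prime factorisation of $B(m, n)$ equals $2s_2(n)$.
   Context: For positive integers $m$ and $n$, $B(m, n)$ denotes the number of balanced colourings of a $2m \times 2n$ rectangular grid, i.e., the number of ways to colour each cell black or white so that, in each row and each column, half of the cells are white and half are black. (An $a \times b$ grid has width $a$ and height $b$: each row consists of $a$ cells and each column of $b$ cells.) For a positive integer $x$, $s_2(x)$ denotes the number of $1$s in the binary expansion of $x$. *)

(* Defs.v *)
From mathcomp Require Import all_boot all_order all_algebra.

Set Implicit Arguments.
Unset Strict Implicit.
Unset Printing Implicit Defensive.

(* A colouring of a grid of width 2m and height 2n is a matrix with 2n rows
   and 2m columns; an entry is true for a white cell, false for a black one. *)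
Definition balanced (m n : nat) (c : 'M[bool]_(2 * n, 2 * m)) : bool :=
  [forall i, (#|[set j | c i j]| == m) && (#|[set j | ~~ c i j]| == m)]
  && [forall j, (#|[set i | c i j]| == n) && (#|[set i | ~~ c i j]| == n)].

Definition B (m n : nat) : nat :=
  #|[set c : 'M[bool]_(2 * n, 2 * m) | balanced c]|.

(* odd (x %/ 2 ^ i) is the binary digit of x of weight 2 ^ i; since x < 2 ^ x,
   all digits at positions i >= x vanish. *)
Definition s2 (x : nat) : nat := \sum_(i < x) odd (x %/ 2 ^ i).

(* Main.v *)
Require Import Defs.
From mathcomp Require Import all_boot all_order all_algebra.
From mathcomp Require Import zify.

Set Implicit Arguments.
Unset Strict Implicit.
Unset Printing Implicit Defensive.

(** Group the [2 * m] columns into [m] pairs, indexed by a type [C] of odd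
    cardinality. A row then has a pattern [y : C -> option bool]: [y c] is
    [Some b] if the row has colour [b] in both columns of the pair [c], and
    [None] if the pair is mixed in that row. Let [N y] be the number of rows
    with pattern [y], and [o_c] the number of rows that are mixed at [c]. In a
    balanced grid exactly half of the rows mixed at [c] are white on the left,
    and conversely any such choice of halves unfolds the patterns to a balanced
    grid, as soon as [N] is [admissible]. Hence ([card_balanced_grid]) [B m n]
    is the sum over all admissible [N] of the weights
      (2n)! / (prod_y (N y)!) * prod_c 'C(o_c, o_c / 2).

    By Legendre's formula ([logn_weight]) the exponent of 2 in a weight is
    [s2 n] plus the sum over [t >= 1] of
      gap_t = 2 [n / 2^t] + sum_c (digit t of o_c) - sum_y [N y / 2^t],
    where the brackets denote integer parts. Superadditivity of integer parts
    gives [gap_t >= 0]. The gap at [t + 1] is smaller than the digit [t] of [n]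
    only if it vanishes while that digit is 1; then the superadditivity
    estimates are equalities, and because every pattern has a mixed pair ([m]
    is odd) this forces [gap_t >= 2] ([deficit_compensated]). So each deficit
    is paid for one step earlier, the gaps add up to at least [s2 n], and each
    weight is divisible by [2 ^ (2 * s2 n)] ([logn_weight_ge]).

    It remains to see that the number of admissible [N] whose weight has
    exponent exactly [2 * s2 n] is odd. Exchanging the two colours and rotating
    the first [2 ^ k] of the [2 ^ k + 1] pairs act on these [N] by permutations
    whose order is a power of 2, so only the [N] fixed by both matter. For such
    an [N] a digit 1 in [o_c] for a rotated pair [c] occurs in [2 ^ k >= 2]
    columns at once and makes the sum of the gaps too large; so only the last
    pair is ever mixed. Then at each [t] at most two patterns have multiplicity
    with digit 1 at [t]. Since the set of these patterns is stable under both
    symmetries, rotating one of them must exchange its colours: it alternates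
    in colour. So [N] takes the value [n] at the two alternating patterns and
    vanishes elsewhere; there is exactly one such [N] ([symmetric_minimal]). *)

(** * Binary digits and factorials *)

Lemma divn_pow2S x t : x %/ 2 ^ t = 2 * (x %/ 2 ^ t.+1) + odd (x %/ 2 ^ t).
Proof. by rewrite expnSr divnMA -[LHS]odd_double_half divn2; lia. Qed.

Lemma sum_widen (F : nat -> nat) a K : a <= K ->
  (forall t, a <= t -> F t = 0) -> \sum_(t < K) F t = \sum_(t < a) F t.
Proof.
move=> le_aK F0; rewrite -!(big_mkord xpredT) (big_cat_nat _ le_aK) //=.
rewrite [X in _ + X]big_nat_cond [X in _ + X]big1 ?addn0 // => t.
by rewrite andbT => /andP[/F0].
Qed.

Lemma s2_widen x K : x <= K -> s2 x = \sum_(t < K) odd (x %/ 2 ^ t).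
Proof.
move=> le_xK; apply/esym/(sum_widen (F := fun t => odd (x %/ 2 ^ t))) => // t le_xt.
by rewrite divn_small //; apply: leq_ltn_trans le_xt (ltn_expl t _).
Qed.

(** Legendre's formula, summed up to a bound [K] that several factorials can
    share, so that their formulas can be combined one index at a time. *)
Lemma logn_fact_widen x K : x <= K -> logn 2 x`! = \sum_(t < K) x %/ 2 ^ t.+1.
Proof.
move=> le_xK; rewrite logn_fact // big_add1 /= big_mkord.
apply/esym/(sum_widen (F := fun t => x %/ 2 ^ t.+1)) => // t le_xt.
by rewrite divn_small //; apply: leq_ltn_trans le_xt (ltnW (ltn_expl t.+1 _)).
Qed.

Lemma leq_sum_divn (I : finType) (P : pred I) (F : I -> nat) d :
  \sum_(i | P i) F i %/ d <= (\sum_(i | P i) F i) %/ d.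
Proof.
apply: (big_ind2 (fun a b => a <= b %/ d)) => // a1 b1 a2 b2 le1 le2.
apply: leq_trans (leq_add le1 le2) _; have [->|d_gt0] := posnP d.
  by rewrite !divn0.
by rewrite divnD // leq_addr.
Qed.

Lemma logn_prodn p (I : finType) (P : pred I) (F : I -> nat) :
  (forall i, 0 < F i) ->
  logn p (\prod_(i | P i) F i) = \sum_(i | P i) logn p (F i).
Proof.
move=> F_gt0; suff [] : 0 < \prod_(i | P i) F i /\
   logn p (\prod_(i | P i) F i) = \sum_(i | P i) logn p (F i) by [].
elim/big_rec2: _ => [|i m e _ [e0 IH]]; first by rewrite logn1.
by rewrite muln_gt0 F_gt0 e0 lognM // IH.
Qed.

(** Where [g] falls short of [b], it does so by one, and the preceding value
    of [g] is at least 2, thus exceeds that of [b] by one or more. The credit [e]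
    propagates a strict inequality that holds from the index [t0] on. *)
Lemma surplus (g b : nat -> nat) t0 e K :
  (forall t, b t <= 1) ->
  (forall t, g t.+1 < b t -> 2 <= g t) ->
  \sum_(t < t0) b t + (g t0.+1 < b t0) + e <= \sum_(t < t0) g t.+1 ->
  t0 <= K -> \sum_(t < K) b t + (g K.+1 < b K) + e <= \sum_(t < K) g t.+1.
Proof.
move=> b1 gb base; elim: K => [|K IH]; first by rewrite leqn0 => /eqP t0E; move: base; rewrite t0E.
rewrite leq_eqVlt => /predU1P[<- //|]; rewrite ltnS => /IH {IH}.
rewrite !big_ord_recr /=; have := gb K; have := gb K.+1.
have := b1 K; have := b1 K.+1.
by case: (ltnP (g K.+1) (b K)); case: (ltnP (g K.+2) (b K.+1)); lia.
Qed.

(** * Multiplicities of row patterns and their gaps *)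

Section Patterns.

Variable C : finType.
Implicit Types (N : {ffun C -> option bool} -> nat) (n t : nat) (c : C).
Local Notation pattern := {ffun C -> option bool}.

Definition column_count N c (o : option bool) : nat := \sum_(y : pattern | y c == o) N y.

Definition mixed_bit N t c : nat := odd (column_count N c None %/ 2 ^ t).

Definition odd_patterns N t : {set pattern} := [set y | odd (N y %/ 2 ^ t)].

(** The subtraction is not truncated for admissible [N], by [floor_le]. *)
Definition gap n N t : nat :=
  2 * (n %/ 2 ^ t) + \sum_c mixed_bit N t c - \sum_(y : pattern) N y %/ 2 ^ t.

(** The families of multiplicities that balanced grids have: the column pairs
    contribute the second condition and the rows the third one, see
    [balanced_gridE]. *)
Definition admissible n N : bool :=
  [&& \sum_(y : pattern) N y == 2 * n,
      [forall c, column_count N c (Some true) == column_count N c (Some false)]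
    & [forall y : pattern, (0 < N y) ==>
        (#|[set c | y c == Some true]| == #|[set c | y c == Some false]|)]].

Lemma sum_by_value (F : pattern -> nat) c :
  \sum_y F y = \sum_(y : pattern | y c == Some true) F y
    + \sum_(y : pattern | y c == Some false) F y
    + \sum_(y : pattern | y c == None) F y.
Proof.
rewrite (bigID (fun y : pattern => y c == None)) /= addnC; congr (_ + _).
rewrite (bigID (fun y : pattern => y c == Some true)) /=.
by congr (_ + _); apply: eq_bigl => y; case: (y c) => [[]|].
Qed.

(** The white and the black pairs being equinumerous, the number of mixed
    pairs has the parity of [#|C|]. *)
Lemma has_mixed (y : pattern) : odd #|C| ->
  #|[set c | y c == Some true]| = #|[set c | y c == Some false]| ->
  exists c, y c = None.
Proof.
move=> oddC eq_tf; have [/existsP[c /eqP yc]|/existsPn noN] := boolP [exists c, y c == None].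
  by exists c.
exfalso; move: oddC; apply/negP.
rewrite -[#|C|]cardsT -(cardsID [set c | y c == Some true]) setTI.
rewrite (_ : _ :\: _ = [set c | y c == Some false]) ?eq_tf ?addnn ?odd_double //.
apply/setP=> c; rewrite !inE andbT; move/eqP: (noN c).
by case: (y c) => [[]|].
Qed.

Section Admissible.

Variables (n : nat) (N : pattern -> nat).
Hypothesis admN : admissible n N.

Lemma admissible_total : \sum_(y : pattern) N y = 2 * n.
Proof. by case/and3P: admN => /eqP. Qed.

Lemma admissible_balance c : column_count N c (Some true) = column_count N c (Some false).
Proof. by case/and3P: admN => _ /forallP/(_ c)/eqP. Qed.

Lemma admissible_pattern (y : pattern) : 0 < N y ->
  #|[set c | y c == Some true]| = #|[set c | y c == Some false]|.
Proof. by case/and3P: admN => _ _ /forallP/(_ y)/implyP imp /imp/eqP. Qed.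

Lemma column_count_mixed c : column_count N c None = 2 * (n - column_count N c (Some true)).
Proof.
have := admissible_total; rewrite (sum_by_value _ c) -!/(column_count N c _).
rewrite -admissible_balance.
by move: (column_count N c None) (column_count N c (Some true)) => a b; lia.
Qed.

Lemma column_count_le c : column_count N c (Some true) <= n.
Proof.
have := admissible_total; rewrite (sum_by_value _ c) -!/(column_count N c _).
rewrite -admissible_balance.
by move: (column_count N c None) (column_count N c (Some true)) => a b; lia.
Qed.

(** With [w] white, [w] black and [2 (n - w)] mixed rows at [c], superadditivity
    bounds the integer parts over the white and over the black patterns, and then
    those of [w] and [n - w] by that of [n]. The sum over the mixed patterns stays
    on the right, so that equality in [floor_le] gives information about it. *)
Lemma floor_bound c t :
  \sum_(y : pattern) N y %/ 2 ^ t + column_count N c None %/ 2 ^ t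
    <= 2 * (n %/ 2 ^ t) + mixed_bit N t c
       + \sum_(y : pattern | y c == None) N y %/ 2 ^ t.
Proof.
rewrite (sum_by_value _ c).
have := leq_sum_divn (fun y : pattern => y c == Some true) N (2 ^ t).
have := leq_sum_divn (fun y : pattern => y c == Some false) N (2 ^ t).
rewrite -!/(column_count N c _) -admissible_balance /mixed_bit.
have := divn_pow2S (column_count N c None) t.
have -> : column_count N c None %/ 2 ^ t.+1 = (n - column_count N c (Some true)) %/ 2 ^ t.
  by rewrite column_count_mixed expnS divnMl.
have : (n - column_count N c (Some true)) %/ 2 ^ t + column_count N c (Some true) %/ 2 ^ t <= n %/ 2 ^ t.
  by rewrite -[X in _ <= X %/ _](subnK (column_count_le c)) divnD ?expn_gt0 // leq_addr.
move: (\sum_(y : pattern | y c == Some true) _) (\sum_(y : pattern | y c == Some false) _).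
move: (\sum_(y : pattern | y c == None) _) (column_count N c (Some true)) (column_count N c None).
by move=> s3 a z s1 s2; lia.
Qed.

Lemma floor_le c t :
  \sum_(y : pattern) N y %/ 2 ^ t <= 2 * (n %/ 2 ^ t) + mixed_bit N t c.
Proof.
have := floor_bound c t.
have := leq_sum_divn (fun y : pattern => y c == None) N (2 ^ t).
rewrite -!/(column_count N c None).
move: (\sum_y _) (\sum_(y : pattern | y c == None) _ %/ _) (column_count N c None %/ _).
by move=> a b d; lia.
Qed.

Lemma gapK (c : C) t :
  gap n N t + \sum_(y : pattern) N y %/ 2 ^ t = 2 * (n %/ 2 ^ t) + \sum_c mixed_bit N t c.
Proof.
rewrite subnK // (leq_trans (floor_le c t)) // leq_add2l.
by rewrite (bigD1 c) //= leq_addr.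
Qed.

Lemma gap_ge c t : \sum_(c' | c' != c) mixed_bit N t c' <= gap n N t.
Proof.
have := gapK c t; have := floor_le c t.
rewrite [\sum_(c : C) _](bigD1 c) //=.
by move: (\sum_y _) (\sum_(i | i != c) _) => a b; lia.
Qed.

Lemma mixed_bit0 c : mixed_bit N 0 c = 0.
Proof. by rewrite /mixed_bit column_count_mixed expn0 divn1 mul2n odd_double. Qed.

Lemma gap0 : gap n N 0 = 0.
Proof.
rewrite /gap big1 => [|c _]; last exact: mixed_bit0.
rewrite expn0 divn1 addn0; under eq_bigr do rewrite divn1.
by rewrite admissible_total subnn.
Qed.

Lemma sum_floor_step (P : pred pattern) t :
  \sum_(y | P y) N y %/ 2 ^ t
    = 2 * (\sum_(y | P y) N y %/ 2 ^ t.+1) + #|[set y in odd_patterns N t | P y]|.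
Proof.
rewrite (eq_bigr _ (fun y _ => divn_pow2S (N y) t)) big_split -big_distrr /=.
congr (_ + _); rewrite -sum1_card big_mkcond [RHS]big_mkcond /=.
by apply: eq_bigr => y _; rewrite !inE; case: (P y) (odd _) => [] [].
Qed.

Lemma odd_pattern_gt0 t y : y \in odd_patterns N t -> 0 < N y.
Proof. by rewrite inE; case: (N y) => [|//]; rewrite div0n. Qed.

Section Deficit.

Variable t : nat.
Hypotheses (C_gt1 : 1 < #|C|) (gap_eq0 : gap n N t.+1 = 0).

(** A vanishing gap kills the digits of all columns but one, for any choice
    of that one. *)
Lemma deficit_bit c : mixed_bit N t.+1 c = 0.
Proof.
have [c' c'c] : exists c', c != c'.
  apply/existsP; rewrite -[[exists c', _]]negbK negb_exists.
  apply: contraL C_gt1 => /forallP eq_c; rewrite -leqNgt -cardsT -(cards1 c).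
  by apply: subset_leq_card; apply/subsetP=> d _; rewrite inE eq_sym -[_ == _]negbK eq_c.
have := gap_ge c' t.+1; rewrite gap_eq0 (bigD1 c) //= leqn0 addn_eq0.
by case/andP=> /eqP.
Qed.

(** When the gap vanishes at [t.+1], the estimate [floor_bound] is an equality
    there, so the integer parts at [t.+1] of the mixed multiplicities add up
    without carry; at [t] this leaves only the digit of their sum. *)
Lemma deficit_mixed c :
  #|[set y in odd_patterns N t | y c == None]| <= mixed_bit N t c.
Proof.
have := floor_bound c t.+1; have := gapK c t.+1; rewrite gap_eq0 add0n deficit_bit.
rewrite [\sum_c _]big1 => [|d _]; last exact: deficit_bit.
rewrite !addn0 => ->; rewrite leq_add2l.
have := leq_sum_divn (fun y : pattern => y c == None) N (2 ^ t).
rewrite (sum_floor_step (fun y : pattern => y c == None)) -!/(column_count N c None).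
rewrite (divn_pow2S (column_count N c None) t) -/(mixed_bit N t c).
move: #|_| (\sum_(y : pattern | _) _) (column_count N c None %/ 2 ^ t.+1).
by move=> a b d; lia.
Qed.

(** An integer part at [t] is twice the one at [t.+1] plus a digit; at [t.+1]
    the estimate [floor_le] is an equality. *)
Lemma deficit_gap : odd (n %/ 2 ^ t) ->
  gap n N t + #|odd_patterns N t| = 2 + \sum_c mixed_bit N t c.
Proof.
move=> odd_n; have /card_gt0P[c _] := ltnW C_gt1.
have := gapK c t.+1; rewrite gap_eq0 add0n.
rewrite [\sum_c mixed_bit N t.+1 c]big1 => [|d _]; last exact: deficit_bit.
rewrite addn0 => tight; have := gapK c t.
rewrite (sum_floor_step xpredT) tight (divn_pow2S n t) odd_n.
have -> : [set y in odd_patterns N t | true] = odd_patterns N t.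
  by apply/setP=> y; rewrite !inE andbT.
by move: #|_| (\sum_c _) (gap _ _ _) => a b d; lia.
Qed.

End Deficit.

(** In [deficit_gap] the digits of the columns outweigh [odd_patterns]: by
    [deficit_mixed] each column accounts for the odd patterns that are mixed
    there, and each pattern is mixed somewhere. *)
Lemma deficit_compensated t : odd #|C| -> 1 < #|C| ->
  gap n N t.+1 < odd (n %/ 2 ^ t) -> 2 <= gap n N t.
Proof.
move=> C_odd C_gt1 lt_gap.
have gap_eq0 : gap n N t.+1 = 0 by case: odd lt_gap; case: gap.
have odd_n : odd (n %/ 2 ^ t) by case: odd lt_gap.
have := deficit_gap C_gt1 gap_eq0 odd_n.
suff le_bits : #|odd_patterns N t| <= \sum_c mixed_bit N t c.
  by move: #|_| (\sum_c _) (gap _ _ _) le_bits => a b d; lia.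
apply: (@leq_trans (\sum_c #|[set y in odd_patterns N t | y c == None]|)); last first.
  by apply: leq_sum => c _; apply: deficit_mixed.
apply: (@leq_trans #|\bigcup_c [set y in odd_patterns N t | y c == None]|).
  apply: subset_leq_card; apply/subsetP=> y y_odd.
  have [c yc] := has_mixed C_odd (admissible_pattern (odd_pattern_gt0 y_odd)).
  by apply/bigcupP; exists c; rewrite ?inE ?yc ?eqxx ?andbT; move: y_odd; rewrite ?inE.
elim/big_rec2: _ => [|c a B _ le_aB]; first by rewrite cards0.
by apply: leq_trans (leq_card_setU _ _) _; rewrite leq_add2l.
Qed.

Lemma gap_surplus K : odd #|C| -> 1 < #|C| ->
  \sum_(t < K) odd (n %/ 2 ^ t) + (gap n N K.+1 < odd (n %/ 2 ^ K))
    <= \sum_(t < K) gap n N t.+1.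
Proof.
move=> C_odd C_gt1; pose b t : nat := odd (n %/ 2 ^ t).
rewrite -[X in X <= _]addn0; apply: (@surplus _ b 0 0) => // [t|t|].
- by rewrite /b; case: odd.
- exact: deficit_compensated.
rewrite !big_ord0 addn0 add0n leqn0 eqb0; apply/negP => lt_gb.
by have := deficit_compensated C_odd C_gt1 lt_gb; rewrite gap0.
Qed.

End Admissible.
End Patterns.

(** * The multinomial coefficient *)

(** Induction on [n]: removing the value [y] at [ord0] lowers [N] by one at
    [y], so that [N y * n`!] is the contribution of [y], and these add up to
    [n.+1 * n`!]. *)
Lemma card_fibers (T : finType) n (N : T -> nat) : \sum_y N y = n ->
  #|[set f : {ffun 'I_n -> T} | [forall y, #|[set i | f i == y]| == N y]]|
    * \prod_y (N y)`! = n`!.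
Proof.
elim: n N => [|n IH] N sumN.
  have N0 y : N y = 0.
    by apply/eqP; rewrite -leqn0 -sumN (bigD1 y) //= leq_addr.
  rewrite [\prod_y _]big1 => [|y _]; last by rewrite N0.
  rewrite muln1 (_ : [set f | _] = setT) ?cardsT ?card_ffun ?card_ord ?expn0 //.
  apply/setP=> f; rewrite !inE; apply/forallP=> y; rewrite N0 cards_eq0.
  by apply/eqP/setP=> -[].
pose cons (y : T) (g : {ffun 'I_n -> T}) : {ffun 'I_n.+1 -> T} :=
  [ffun i => if unlift ord0 i is Some j then g j else y].
have cons_inj y : injective (cons y).
  move=> g1 g2 /ffunP eq_g; apply/ffunP=> j.
  by have := eq_g (lift ord0 j); rewrite !ffunE liftK.
pose less (y z : T) := N z - (z == y).
have card_cons y g z : #|[set i | cons y g i == z]| = (z == y) + #|[set i | g i == z]|.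
  rewrite -!sum1dep_card big_mkcond big_ord_recl /= ffunE unlift_none eq_sym.
  rewrite [in RHS]big_mkcond /=; congr (_ + _).
  by apply: eq_bigr => i _; rewrite ffunE liftK.
set S := [set f | _].
have -> : #|S| = \sum_(y | 0 < N y)
   #|[set g : {ffun 'I_n -> T} | [forall z, #|[set i | g i == z]| == less y z]]|.
  rewrite -sum1_card (partition_big (fun f : {ffun 'I_n.+1 -> T} => f ord0) (fun y => 0 < N y)) /=.
    apply: eq_bigr => y Ny; rewrite sum1dep_card -[RHS](card_imset _ (cons_inj y)).
    apply: eq_card => f; rewrite !inE; apply/andP/imsetP.
      case=> /forallP fN /eqP f0; exists [ffun j => f (lift ord0 j)].
        have fE : f = cons y [ffun j => f (lift ord0 j)].
          apply/ffunP=> i; rewrite ffunE; case: unliftP => [j|] ->; by rewrite ?ffunE.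
        have := card_cons y [ffun j => f (lift ord0 j)]; rewrite -fE => card_f.
        by rewrite inE; apply/forallP=> z; rewrite /less -(eqP (fN z)) card_f addKn.
      apply/ffunP=> i; rewrite ffunE; case: unliftP => [j|] ->; by rewrite ?ffunE.
    case=> g; rewrite inE => /forallP gN ->; rewrite ffunE unlift_none eqxx; split=> //.
    apply/forallP=> z; rewrite card_cons (eqP (gN z)) /less.
    by case: (z =P y) => [->|]; [rewrite subnKC | rewrite subn0].
  move=> f; rewrite inE => /forallP/(_ (f ord0))/eqP <-.
  by apply/card_gt0P; exists ord0; rewrite inE.
rewrite big_distrl /= factS -sumN big_distrl /= [RHS](bigID (fun y => 0 < N y)) /=.
rewrite [X in _ = _ + X]big1 ?addn0 => [|y]; last by rewrite -eqn0Ngt => /eqP ->.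
apply: eq_bigr => y Ny.
rewrite -(IH (less y)).
  rewrite mulnCA; congr (_ * _).
  rewrite (bigD1 y) //= [in RHS](bigD1 y) //= /less eqxx mulnA subn1.
  rewrite -[in LHS](prednK Ny) factS; congr (_ * _).
    by rewrite prednK.
  by apply: eq_bigr => z /negPf ->; rewrite subn0.
rewrite (bigD1 y) //= /less eqxx.
rewrite (eq_bigr N) => [|z /negPf ->]; last by rewrite subn0.
move: sumN; rewrite (bigD1 y) //=.
by case: (N y) Ny => // k _; rewrite subn1 /= addSn => -[].
Qed.

(** * The power of 2 in a weight *)

Section Weight.

Variable C : finType.
Local Notation pattern := {ffun C -> option bool}.
Implicit Types (N : pattern -> nat) (n : nat).

(** The number of balanced grids whose folded rows have multiplicities [N]. *)
Definition weight n N : nat :=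
  (2 * n)`! %/ \prod_(y : pattern) (N y)`!
    * \prod_c 'C(column_count N c None, (column_count N c None)./2).

Variables (n : nat) (N : pattern -> nat).
Hypotheses (admN : admissible n N) (C_odd : odd #|C|).

Lemma multinomialK :
  (2 * n)`! %/ \prod_(y : pattern) (N y)`! * \prod_(y : pattern) (N y)`! = (2 * n)`!.
Proof.
rewrite divnK //; apply/dvdnP.
by rewrite -(card_fibers (admissible_total admN)); eexists.
Qed.

Lemma count_le_total (y : pattern) : N y <= 2 * n.
Proof. by rewrite -(admissible_total admN) (bigD1 y) //= leq_addr. Qed.

Lemma half_mixed c : (column_count N c None)./2 = n - column_count N c (Some true).
Proof. by rewrite (column_count_mixed admN) mul2n doubleK. Qed.

Lemma weight_gt0 : 0 < weight n N.
Proof.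
rewrite muln_gt0; apply/andP; split.
  by have := fact_gt0 (2 * n); rewrite -[X in 0 < X]multinomialK muln_gt0 => /andP[].
apply: prodn_gt0 => c; rewrite bin_gt0 half_mixed (column_count_mixed admN).
by rewrite leq_pmull.
Qed.

Lemma logn_central_bin w : logn 2 'C(2 * w, w) + 2 * logn 2 w`! = logn 2 (2 * w)`!.
Proof.
have <- : 'C(2 * w, w) * (w`! * w`!) = (2 * w)`!.
  have := @bin_fact (2 * w) w; rewrite leq_pmull // => /(_ isT).
  by rewrite {2}mul2n -addnn addnK.
rewrite !lognM ?muln_gt0 ?fact_gt0 ?bin_gt0 ?leq_pmull //.
by rewrite addnn -mul2n.
Qed.

(** Legendre's formula for each factorial, added up for a fixed index. The
    binomial coefficients leave the digits of the [o_c], and the term [s2 n]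
    comes from [(2 * n) %/ 2 ^ t.+1 = 2 * (n %/ 2 ^ t.+1) + odd (n %/ 2 ^ t)]. *)
Lemma logn_weight K : 2 * n <= K ->
  logn 2 (weight n N) = s2 n + \sum_(t < K) gap n N t.+1.
Proof.
move=> le_nK.
have /card_gt0P[c0 _] : 0 < #|C| by case: #|C| C_odd.
have : logn 2 (weight n N) + \sum_(y : pattern) logn 2 (N y)`!
    + \sum_c 2 * logn 2 (n - column_count N c (Some true))`!
  = logn 2 (2 * n)`! + \sum_c logn 2 (column_count N c None)`!.
  rewrite -[X in _ = logn 2 X + _]multinomialK.
  have:= weight_gt0; rewrite muln_gt0 => /andP[mult_gt0 _].
  have fact_N_gt0 (y : pattern) : 0 < (N y)`! by apply: fact_gt0.
  have bin_gt0 c : 0 < 'C(column_count N c None, (column_count N c None)./2).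
    by rewrite half_mixed (column_count_mixed admN) bin_gt0 leq_pmull.
  rewrite !lognM // ?prodn_gt0 // (logn_prodn _ _ fact_N_gt0) (logn_prodn _ _ bin_gt0).
  rewrite -!addnA; congr (_ + _); rewrite addnCA; congr (_ + _).
  rewrite -big_split /=; apply: eq_bigr => c _.
  by rewrite half_mixed (column_count_mixed admN) logn_central_bin.
have le_count c o : column_count N c o <= 2 * n.
  rewrite -(admissible_total admN) /column_count [X in _ <= X](bigID (fun y : pattern => y c == o)) /=.
  exact: leq_addr.
have widen x : x <= 2 * n -> logn 2 x`! = \sum_(t < K) x %/ 2 ^ t.+1.
  by move=> le_x; apply: logn_fact_widen (leq_trans le_x le_nK).
have -> : \sum_(y : pattern) logn 2 (N y)`!
    = \sum_(t < K) \sum_(y : pattern) N y %/ 2 ^ t.+1.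
  by rewrite exchange_big; apply: eq_bigr => y _; apply/widen/count_le_total.
have -> : \sum_c 2 * logn 2 (n - column_count N c (Some true))`!
    = \sum_(t < K) \sum_c 2 * ((n - column_count N c (Some true)) %/ 2 ^ t.+1).
  rewrite exchange_big; apply: eq_bigr => c _; rewrite -big_distrr widen //.
  by rewrite (leq_trans (leq_subr _ _)) ?leq_pmull.
have -> : \sum_c logn 2 (column_count N c None)`!
    = \sum_(t < K) \sum_c column_count N c None %/ 2 ^ t.+1.
  by rewrite exchange_big; apply: eq_bigr => c _; apply/widen/le_count.
rewrite widen // -!addnA -!big_split /= => eqw.
rewrite (@s2_widen n K); last by apply: leq_trans le_nK; rewrite leq_pmull.
apply/eqP; rewrite -big_split -(eqn_add2r (\sum_(t < K) (\sum_(y : pattern) N y %/ 2 ^ t.+1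
  + \sum_c 2 * ((n - column_count N c (Some true)) %/ 2 ^ t.+1)))) eqw -big_split /=.
apply/eqP/eq_bigr => t _.
have -> : \sum_c column_count N c None %/ 2 ^ t.+1 = \sum_c mixed_bit N t.+1 c
    + \sum_c 2 * ((n - column_count N c (Some true)) %/ 2 ^ t.+1).
  rewrite -big_split; apply: eq_bigr => c _.
  rewrite divn_pow2S addnC; congr (_ + 2 * _).
  by rewrite (column_count_mixed admN) [2 ^ t.+2]expnS divnMl.
have := gapK admN c0 t.+1; have := divn_pow2S n t.
have -> : (2 * n) %/ 2 ^ t.+1 = n %/ 2 ^ t by rewrite expnS divnMl.
move: (gap _ _ _) (\sum_c mixed_bit _ _ _) (\sum_c 2 * _) (\sum_(y : pattern) _).
by move=> a b d e; lia.
Qed.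

Lemma logn_weight_ge : 1 < #|C| -> 2 * s2 n <= logn 2 (weight n N).
Proof.
move=> C_gt1; set K := 2 * n; rewrite (logn_weight (leqnn K)) mul2n -addnn leq_add2l.
rewrite (@s2_widen n K) ?leq_pmull //.
exact: leq_trans (leq_addr _ _) (gap_surplus admN K C_odd C_gt1).
Qed.

End Weight.

(** * Folding a balanced grid *)

Section Folding.

Variables (C : finType) (n : nat).
Local Notation pattern := {ffun C -> option bool}.
Local Notation folded := {ffun 'I_(2 * n) -> pattern}.
Local Notation grid := {ffun 'I_(2 * n) -> {ffun C * bool -> bool}}.
Implicit Types (A : grid) (Y : folded) (c : C) (i : 'I_(2 * n)).

Definition balanced_grid A : bool :=
  [forall i, (#|[set p | A i p]| == #|C|) && (#|[set p | ~~ A i p]| == #|C|)]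
  && [forall p, (#|[set i | A i p]| == n) && (#|[set i | ~~ A i p]| == n)].

Definition fold A : folded :=
  [ffun i => [ffun c => if A i (c, true) == A i (c, false) then Some (A i (c, true)) else None]].

Definition multiplicity Y (y : pattern) : nat := #|[set i | Y i == y]|.

Definition left_white A c : {set 'I_(2 * n)} :=
  [set i | A i (c, true) && ~~ A i (c, false)].

Definition mixed_rows Y c : {set 'I_(2 * n)} := [set i | Y i c == None].

Lemma column_count_multiplicity Y c o :
  column_count (multiplicity Y) c o = #|[set i | Y i c == o]|.
Proof.
rewrite -sum1dep_card (partition_big (fun i => Y i) (fun y : pattern => y c == o)) //=.
apply: eq_bigr => y yc; rewrite sum1dep_card; apply: eq_card => i; rewrite !inE.
by case: eqP => [->|]; rewrite ?yc ?andbF.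
Qed.

Lemma sum_multiplicity Y : \sum_(y : pattern) multiplicity Y y = 2 * n.
Proof.
rewrite -[RHS]card_ord -sum1_card (partition_big (fun i => Y i) xpredT) //=.
by apply: eq_bigr => y _; rewrite sum1dep_card.
Qed.

Lemma card_by_value (T : finType) (f : T -> option bool) :
  #|T| = #|[set x | f x == Some true]| + #|[set x | f x == Some false]| + #|[set x | f x == None]|.
Proof.
rewrite -!sum1dep_card -sum1_card (bigID (fun x => f x == None)) /= addnC; congr (_ + _).
rewrite (bigID (fun x => f x == Some true)) /=.
by congr (_ + _); apply: eq_bigl => x; case: (f x) => [[]|].
Qed.

Lemma foldE A i c :
  fold A i c = if A i (c, true) == A i (c, false) then Some (A i (c, true)) else None.
Proof. by rewrite !ffunE. Qed.

Lemma card_row A i (f : bool -> bool) :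
  #|[set p | f (A i p)]|
   = 2 * (f true * #|[set c | fold A i c == Some true]|
          + f false * #|[set c | fold A i c == Some false]|)
     + (f true + f false) * #|[set c | fold A i c == None]|.
Proof.
rewrite -!sum1dep_card big_mkcond.
rewrite (eq_bigr (fun p => if f (A i (p.1, p.2)) then 1 else 0)) => [|[c b] _] //.
rewrite -(pair_bigA _ (fun c b => if f (A i (c, b)) then 1 else 0)) /=.
rewrite !big_distrr /= ![\sum_(c in C | _ == _) _]big_mkcond -big_split big_distrr -big_split.
apply: eq_bigr => c _; rewrite big_bool foldE /=.
by case: (A i (c, true)) (A i (c, false)) => [] [] /=; case: (f true) (f false) => [] [].
Qed.

(** The function [f] lets one proof count the white and the black cells of
    either column of the pair. *)
Lemma card_column A c (f : bool -> bool -> bool) :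
  #|[set i | f (A i (c, true)) (A i (c, false))]|
   = f true true * #|[set i | fold A i c == Some true]|
   + f false false * #|[set i | fold A i c == Some false]|
   + f true false * #|left_white A c|
   + f false true * (#|mixed_rows (fold A) c| - #|left_white A c|).
Proof.
have -> : #|mixed_rows (fold A) c| - #|left_white A c|
    = #|[set i | ~~ A i (c, true) && A i (c, false)]|.
  rewrite -(cardsID (left_white A c)) (_ : _ :&: _ = left_white A c).
    rewrite addKn; apply: eq_card => i; rewrite !inE foldE.
    by case: (A i (c, true)) (A i (c, false)) => [] [].
  apply/setP=> i; rewrite !inE foldE.
  by case: (A i (c, true)) (A i (c, false)) => [] [].
rewrite -!sum1_card !big_distrr /= ![\sum_(i in _) _]big_mkcond -!big_split /=.
apply: eq_bigr => i _; rewrite !inE foldE.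
by case: (A i (c, true)) (A i (c, false)) => [] [] /=; rewrite ?muln1 ?addn0 //;
  case: (f _ _).
Qed.

Lemma balanced_column A c :
  [&& #|[set i | A i (c, true)]| == n, #|[set i | ~~ A i (c, true)]| == n,
      #|[set i | A i (c, false)]| == n & #|[set i | ~~ A i (c, false)]| == n]
  = (column_count (multiplicity (fold A)) c (Some true)
      == column_count (multiplicity (fold A)) c (Some false))
    && (#|left_white A c| == #|mixed_rows (fold A) c|./2).
Proof.
rewrite !column_count_multiplicity.
have -> := card_column A c (fun a _ => a); have -> := card_column A c (fun a _ => ~~ a).
have -> := card_column A c (fun _ b => b); have -> := card_column A c (fun _ b => ~~ b).
have := card_by_value (fun i => fold A i c); rewrite card_ord -/(mixed_rows (fold A) c).
have : #|left_white A c| <= #|mixed_rows (fold A) c|.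
  apply: subset_leq_card; apply/subsetP=> i; rewrite !inE foldE.
  by case: (A i (c, true)) (A i (c, false)) => [] [].
rewrite !mul1n !mul0n !addn0 !add0n.
move: #|left_white A c| #|mixed_rows _ c| #|[set i | _ == Some true]|.
move: #|[set i | _ == Some false]| => f l x t le_lx; rewrite mul2n -addnn => sum_n.
apply/and4P/andP => [[/eqP h1 /eqP h2 /eqP h3 /eqP h4]|[/eqP h1 /eqP h2]]; split; apply/eqP; lia.
Qed.

(** A row has as many white as black cells exactly when its pattern has as many
    white as black pairs; the two columns of a pair impose equal numbers of white
    and black rows, and a fair split of the mixed ones. *)
Lemma balanced_gridE A : balanced_grid A =
  admissible n (multiplicity (fold A))
  && [forall c, #|left_white A c| == #|mixed_rows (fold A) c|./2].
Proof.
rewrite /admissible sum_multiplicity eqxx /= /balanced_grid andbC [RHS]andbAC.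
congr (_ && _).
  apply/forallP/andP => [bal|[/forallP eq_tf /forallP half] [c b]].
    have {}bal c : (column_count (multiplicity (fold A)) c (Some true)
        == column_count (multiplicity (fold A)) c (Some false))
      && (#|left_white A c| == #|mixed_rows (fold A) c|./2).
      rewrite -balanced_column; have /andP[-> ->] := bal (c, true).
      by have /andP[-> ->] := bal (c, false).
    by split; apply/forallP => c; have /andP[] := bal c.
  have := balanced_column A c; rewrite eq_tf half => /and4P[w1 b1 w2 b2].
  by case: b; apply/andP.
apply/forallP/forallP => bal.
  move=> y; apply/implyP=> /card_gt0P[i]; rewrite inE => /eqP <-.
  have /andP[] := bal i; rewrite (card_row A i id) (card_row A i negb) => /eqP + /eqP.
  rewrite (card_by_value (fold A i)) /=.
  move: #|_| #|_| #|_| => a b c; lia.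
move=> i; have mult_gt0 : 0 < multiplicity (fold A) (fold A i).
  by apply/card_gt0P; exists i; rewrite inE.
have /implyP/(_ mult_gt0)/eqP := bal (fold A i).
rewrite (card_row A i id) (card_row A i negb) (card_by_value (fold A i)) /=.
by move: #|_| #|_| #|_| => a b c ->; lia.
Qed.

(** A grid with given patterns amounts to the choice, for each pair, of the
    mixed rows that are white on the left. *)
Lemma card_fold_fiber Y (h : C -> nat) :
  #|[set A | (fold A == Y) && [forall c, #|left_white A c| == h c]]|
    = \prod_c 'C(#|mixed_rows Y c|, h c).
Proof.
pose F c : {pred {set 'I_(2 * n)}} :=
  [set S : {set 'I_(2 * n)} | (S \subset mixed_rows Y c) && (#|S| == h c)].
(* a mixed row in [S c] is white on the left, any other on the right *)
pose unfold (S : {ffun C -> {set 'I_(2 * n)}}) : grid :=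
  [ffun i => [ffun p => if Y i p.1 is Some v then v else (i \in S p.1) == p.2]].
have unfoldK (S : {ffun C -> {set 'I_(2 * n)}}) :
    S \in family F -> forall c, left_white (unfold S) c = S c.
  move=> /familyP SF c; apply/setP=> i; rewrite !inE !ffunE /=.
  have := SF c; rewrite !inE => /andP[/subsetP/(_ i) + _]; rewrite inE.
  by case: (Y i c) => [[]|]; case: (i \in S c) => // /(_ isT).
have -> : \prod_c 'C(#|mixed_rows Y c|, h c) = #|family F|.
  rewrite card_family foldrE big_map big_enum; apply: eq_bigr => c _.
  by rewrite -cards_draws; apply: eq_card => S; rewrite !inE.
rewrite -(card_in_imset (f := unfold)); last first.
  move=> S1 S2 S1F S2F eqS; apply/ffunP=> c.
  by rewrite -(unfoldK _ S1F) -(unfoldK _ S2F) eqS.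
apply: eq_card => A; rewrite inE; apply/andP/imsetP.
  case=> /eqP foldA /forallP hA; exists [ffun c => left_white A c].
    apply/familyP=> c; rewrite ffunE inE hA andbT; apply/subsetP=> i.
    by rewrite !inE -foldA foldE; case: (A i (c, true)) (A i (c, false)) => [] [].
  apply/ffunP=> i; apply/ffunP=> -[c b]; rewrite !ffunE /= -foldA foldE inE.
  by case: b; case: (A i (c, true)) (A i (c, false)) => [] [].
case=> S SF ->; split; last first.
  apply/forallP=> c; rewrite unfoldK //.
  by have /familyP/(_ c) := SF; rewrite inE => /andP[].
apply/eqP/ffunP=> i; apply/ffunP=> c; rewrite foldE !ffunE /=.
by case: (Y i c) => [v|]; rewrite ?eqxx //; case: (i \in S c).
Qed.

End Folding.

Section Count.

Variables (C : finType) (n : nat).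
Local Notation pattern := {ffun C -> option bool}.
Local Notation multiplicities := {ffun pattern -> 'I_(2 * n).+1}.

(** The bound [2 * n] on the multiplicities makes them range over a finite type,
    over which weights can be summed. *)
Definition counts (N : multiplicities) (y : pattern) : nat := N y.

Lemma eq_column_count (N1 N2 : pattern -> nat) c o :
  N1 =1 N2 -> column_count N1 c o = column_count N2 c o.
Proof. by move=> eqN; apply: eq_bigr. Qed.

Lemma eq_admissible (N1 N2 : pattern -> nat) :
  N1 =1 N2 -> admissible n N1 = admissible n N2.
Proof.
move=> eqN; rewrite /admissible (eq_bigr N2) //; congr [&& _, _ & _].
  by apply: eq_forallb => c; rewrite !(eq_column_count _ _ eqN).
by apply: eq_forallb => y; rewrite eqN.
Qed.

(** For given multiplicities, [card_fibers] counts the arrangements of the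
    patterns in the rows, and [card_fold_fiber] the grids over each arrangement. *)
Lemma card_balanced_grid :
  #|[set A : {ffun 'I_(2 * n) -> {ffun C * bool -> bool}} | balanced_grid A]|
    = \sum_(N : multiplicities | admissible n (counts N)) weight n (counts N).
Proof.
rewrite -sum1dep_card (partition_big (fold (n := n)) (fun Y => admissible n (multiplicity Y))) /=; last first.
  by move=> A; rewrite balanced_gridE => /andP[].
pose mult (Y : {ffun 'I_(2 * n) -> pattern}) : multiplicities :=
  [ffun y => inord (multiplicity Y y)].
have multE Y : multiplicity Y =1 counts (mult Y).
  move=> y; rewrite /counts ffunE inordK // ltnS -(sum_multiplicity Y) (bigD1 y) //=.
  exact: leq_addr.
rewrite (partition_big mult (fun N => admissible n (counts N))) /=; last first.
  by move=> Y; rewrite (eq_admissible (multE Y)).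
apply: eq_bigr => N admN; rewrite /weight.
rewrite -(card_fibers (admissible_total admN)).
have prod_gt0 : 0 < \prod_(y : pattern) (counts N y)`!.
  by apply: prodn_gt0 => y; apply: fact_gt0.
rewrite mulnK // -sum1dep_card big_distrl /=.
apply: eq_big => [Y|Y /andP[admY /eqP NE]].
  rewrite (eq_admissible (multE Y)); apply/andP/forallP => [[_ /eqP <-] y|eqN].
    by rewrite -multE.
  have NE : mult Y = N.
    by apply/ffunP=> y; apply/val_inj/eqP; have := eqN y; rewrite -/(multiplicity Y y) multE.
  by rewrite NE.
rewrite mul1n sum1dep_card.
rewrite [RHS](eq_bigr (fun c => 'C(#|mixed_rows Y c|, #|mixed_rows Y c|./2))) => [|c _]; last first.
  by rewrite -NE -!(eq_column_count _ _ (multE Y)) column_count_multiplicity.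
rewrite -card_fold_fiber; apply: eq_card => A; rewrite !inE balanced_gridE.
by case: eqP => [->|]; rewrite ?admY ?andbT ?andbF.
Qed.

(** Any bijection of [C * bool] with the columns transports the balance
    conditions. *)
Lemma card_balanced (m : nat) : #|C| = m ->
  B m n = #|[set A : {ffun 'I_(2 * n) -> {ffun C * bool -> bool}} | balanced_grid A]|.
Proof.
move=> cardC.
have cardP : #|{: C * bool}| = 2 * m by rewrite card_prod card_bool cardC mulnC.
pose f (j : 'I_(2 * m)) : C * bool := enum_val (cast_ord (esym cardP) j).
have f_bij : bijective f.
  exists (fun p => cast_ord cardP (enum_rank p)) => [j|p]; rewrite /f.
    by rewrite enum_valK cast_ordKV.
  by rewrite cast_ordK enum_rankK.
have cardf (P : pred (C * bool)) : #|[set j | P (f j)]| = #|[set p | P p]|.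
  rewrite -[RHS](on_card_preimset (f := f)); last exact: onW_bij.
  by apply: eq_card => j; rewrite !inE.
pose g (A : {ffun 'I_(2 * n) -> {ffun C * bool -> bool}}) : 'M[bool]_(2 * n, 2 * m) :=
  (\matrix_(i, j) A i (f j))%R.
have [f' fK f'K] := f_bij.
have g_bij : bijective g.
  exists (fun M : 'M_(_, _) => [ffun i => [ffun p => M i (f' p)]]) => [A|M].
    by apply/ffunP=> i; apply/ffunP=> p; rewrite !ffunE mxE f'K.
  by apply/matrixP=> i j; rewrite mxE !ffunE fK.
rewrite /B -(on_card_preimset (f := g)); last exact: onW_bij.
apply: eq_card => A; rewrite !inE /balanced /balanced_grid cardC.
have col j : (#|[set i | g A i j]| == n) && (#|[set i | ~~ g A i j]| == n)
    = (#|[set i | A i (f j)]| == n) && (#|[set i | ~~ A i (f j)]| == n).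
  by congr ((_ == n) && (_ == n)); apply: eq_card => i; rewrite !inE mxE.
congr (_ && _).
  apply: eq_forallb => i; rewrite -(cardf (A i)) -(cardf (fun p => ~~ A i p)).
  by congr ((_ == m) && (_ == m)); apply: eq_card => j; rewrite !inE mxE.
apply/forallP/forallP=> [bal p|bal j]; last by rewrite col.
by have := bal (f' p); rewrite col f'K.
Qed.

End Count.

(** * Parity and symmetries *)

(** The points that are moved come in pairs [x], [f x]. *)
Lemma odd_card_involution (T : finType) (f : T -> T) (S : {set T}) :
  {in S, forall x, f x \in S} -> {in S, forall x, f (f x) = x} ->
  odd #|S| = odd #|[set x in S | f x == x]|.
Proof.
move: {2}#|S|.+1 (ltnSn #|S|) => m.
elim: m S => // m IH S; rewrite ltnS => le_Sm fS fK.
have [/existsP[x /andP[xS fx]]|/existsPn nofree] := boolP [exists x in S, f x != x]; last first.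
  congr (odd #|pred_of_set _|); apply/setP=> x; rewrite inE.
  by have := nofree x; case: (x \in S) => //=; rewrite negbK => ->.
have fxS : f x \in S :\ x by rewrite !inE fx fS.
have cardS : #|S| = (#|S :\ x :\ f x|).+2 by rewrite (cardsD1 x S) xS (cardsD1 (f x)) fxS.
have memS' y : (y \in S :\ x :\ f x) = [&& y != f x, y != x & y \in S] by rewrite !inE.
rewrite cardS /= negbK (IH (S :\ x :\ f x)).
- congr (odd _); apply: eq_card => y; rewrite !inE.
  case: (f y =P y) => fyy; rewrite ?andbF // !andbT.
  case: (y =P f x) => [yE|_]; first by move: fyy fx; rewrite yE fK // => <-; rewrite eqxx.
  by case: (y =P x) => [yE|//]; move: fyy fx; rewrite yE => ->; rewrite eqxx.
- by apply: leq_trans le_Sm; rewrite cardS.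
- move=> y; rewrite !memS' => /and3P[y1 y2 yS]; rewrite fS // andbT.
  apply/andP; split; apply: contraNneq y2 => eq_f.
    by rewrite -(fK y yS) eq_f fK // eqxx.
  by move: y1; rewrite -eq_f fK ?eqxx.
- by move=> y; rewrite memS' => /and3P[_ _ yS]; apply: fK.
Qed.

(** Replacing [f] by [f \o f] halves the order, and [f] is an involution on
    the fixed points of [f \o f]. *)
Lemma odd_card_fixed (T : finType) (f : T -> T) k (S : {set T}) :
  {in S, forall x, f x \in S} -> {in S, forall x, iter (2 ^ k) f x = x} ->
  odd #|S| = odd #|[set x in S | f x == x]|.
Proof.
elim: k f => [|k IH] f fS fK.
  congr (odd #|pred_of_set _|); apply/setP=> x; rewrite inE.
  by case: (boolP (x \in S)) => //= xS; rewrite [f x](fK _ xS) eqxx.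
rewrite (IH (fun x => f (f x))); last 2 first.
- by move=> x xS; apply/fS/fS.
- move=> x /fK; rewrite expnS mul2n => {2}<-.
  by elim: (2 ^ k) => //= j ->.
rewrite (odd_card_involution (f := f)); last 2 first.
- by move=> x; rewrite !inE => /andP[xS /eqP ->]; rewrite fS ?eqxx.
- by move=> x; rewrite !inE => /andP[xS /eqP].
congr (odd _); apply: eq_card => x; rewrite !inE.
by case: (f x =P x) => [fx|_]; rewrite ?andbF // !fx !eqxx !andbT.
Qed.

Section Symmetry.

Variables (C : finType) (n : nat) (h : C -> C) (s : bool -> bool).
Hypotheses (h_bij : bijective h) (s_inv : involutive s).
Local Notation pattern := {ffun C -> option bool}.
Implicit Types (N : pattern -> nat) (y : pattern).

(** Permuting the pairs by [h] and the colours by [s] in one operation treats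
    the two symmetries of the argument alike. *)
Definition move_pattern y : pattern := [ffun c => omap s (y (h c))].

Let omapK : involutive (omap s).
Proof. by case=> [b|] //=; rewrite s_inv. Qed.

Lemma move_pattern_bij : bijective move_pattern.
Proof.
have [h' hK h'K] := h_bij.
exists (fun y => [ffun c => omap s (y (h' c))]) => y; apply/ffunP=> c;
  by rewrite !ffunE omapK ?h'K ?hK.
Qed.

Lemma column_count_move N c o :
  column_count (N \o move_pattern) (h c) o = column_count N c (omap s o).
Proof.
rewrite [RHS](reindex _ (onW_bij _ move_pattern_bij)).
by apply: eq_bigl => y; rewrite ffunE (inj_eq (inv_inj omapK)).
Qed.

Lemma admissible_move N : admissible n N -> admissible n (N \o move_pattern).
Proof.
have [h' hK h'K] := h_bij.
case/and3P=> /eqP total /forallP bal /forallP supp; apply/and3P; split.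
- by rewrite -total [X in _ == X](reindex _ (onW_bij _ move_pattern_bij)).
- apply/forallP=> c; rewrite -[c]h'K !column_count_move.
  have := bal (h' c); case s_t: (s true); case s_f: (s false) => /=; rewrite ?s_t ?s_f //.
  by rewrite eq_sym.
apply/forallP=> y; apply/implyP => /(implyP (supp _)).
have cardE b : #|[set c | move_pattern y c == Some b]| = #|[set c | y c == Some (s b)]|.
  rewrite -[RHS](on_card_preimset (f := h)); last exact: onW_bij.
  by apply: eq_card => c; rewrite !inE ffunE -(inj_eq (inv_inj omapK)) omapK.
rewrite !cardE.
case s_t: (s true); case s_f: (s false) => //; last first.
- by have := inv_inj s_inv (etrans s_t (esym s_f)).
- by move/eqP->.
- by have := inv_inj s_inv (etrans s_t (esym s_f)).
Qed.

Lemma weight_move N : weight n (N \o move_pattern) = weight n N.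
Proof.
rewrite /weight [in RHS](reindex _ (onW_bij _ move_pattern_bij)) /=; congr (_ * _).
rewrite (reindex _ (onW_bij _ h_bij)) /=.
by apply: eq_bigr => c _; rewrite !column_count_move.
Qed.

Definition move_counts (N : {ffun pattern -> 'I_(2 * n).+1}) : {ffun pattern -> 'I_(2 * n).+1} :=
  [ffun y => N (move_pattern y)].

Lemma counts_move (N : {ffun pattern -> 'I_(2 * n).+1}) : counts (move_counts N) =1 counts N \o move_pattern.
Proof. by move=> y; rewrite /counts ffunE. Qed.

End Symmetry.

(** * Multiplicities fixed by the symmetries *)

Lemma odd_digit_exists x : 0 < x -> exists t, odd (x %/ 2 ^ t).
Proof.
move=> x_gt0; exists (trunc_log 2 x).
have /andP[le_x lt_x] := trunc_log_bounds (isT : 1 < 2) x_gt0.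
suff -> : x %/ 2 ^ trunc_log 2 x = 1 by [].
apply/eqP; rewrite eqn_leq leq_divRL ?expn_gt0 // mul1n le_x andbT.
by rewrite -ltnS ltn_divLR ?expn_gt0 // -expnS.
Qed.

Section Fixed.

Variables (M n : nat).
Hypotheses (M_gt1 : 1 < M) (M_even : ~~ odd M).
Local Notation C := (option 'I_M).
Local Notation pattern := {ffun C -> option bool}.
Local Notation i0 := (Ordinal (ltnW M_gt1)).

Definition swap_pattern : pattern -> pattern := move_pattern id negb.
Definition rotate_pattern : pattern -> pattern := move_pattern (omap (@ordS M)) id.

Definition alternating : pattern := [ffun c : C => omap (fun i : 'I_M => odd i) c].

Lemma card_C_odd : odd #|{: C}|.
Proof. by rewrite card_option card_ord /= M_even. Qed.

Lemma card_C_gt1 : 1 < #|{: C}|.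
Proof. by rewrite card_option card_ord ltnS ltnW. Qed.

Lemma swap_fixed (y : pattern) c : swap_pattern y = y -> y c = None.
Proof. by move/ffunP/(_ c); rewrite ffunE; case: (y c) => [[]|]. Qed.

Lemma swap_mixed (y : pattern) c : (swap_pattern y c == None) = (y c == None).
Proof. by rewrite ffunE; case: (y c). Qed.

Section FixedMinimal.

Variable N : pattern -> nat.
Hypotheses (admN : admissible n N)
  (swapN : forall y, N (swap_pattern y) = N y)
  (rotateN : forall y, N (rotate_pattern y) = N y)
  (minimal : logn 2 (weight n N) = 2 * s2 n).

Let digit t : nat := odd (n %/ 2 ^ t).

Lemma sum_gap : \sum_(t < 2 * n) gap n N t.+1 = \sum_(t < 2 * n) digit t.
Proof.
apply/(@addnI (s2 n)); rewrite -(logn_weight admN card_C_odd (leqnn _)) minimal.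
by rewrite mul2n -addnn (@s2_widen n (2 * n)) // leq_pmull.
Qed.

Lemma rotate_count i o : column_count N (Some (ordS i)) o = column_count N (Some i) o.
Proof.
have := @column_count_move _ (omap (@ordS M)) id _ (fun _ => erefl) N (Some i) o.
rewrite omap_id => <-; last first.
  by exists (omap (@ord_pred M)) => [[j|]|[j|]] //=; rewrite ?ordSK ?ord_predK.
by apply/eq_column_count => y; rewrite -rotateN.
Qed.

Lemma val_iter_ordS j (i : 'I_M) : val (iter j (@ordS M) i) = (i + j) %% M.
Proof.
elim: j => [|j IH] /=; first by rewrite addn0 modn_small.
by rewrite IH -addn1 modnDml addn1 addnS.
Qed.

Lemma reach (i j : 'I_M) : exists l, iter l (@ordS M) i = j.
Proof.
exists (M - i + j); apply/val_inj; rewrite val_iter_ordS addnA subnKC 1?ltnW //.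
by rewrite modnDl modn_small.
Qed.

Lemma const_count i j o : column_count N (Some i) o = column_count N (Some j) o.
Proof.
have [l <-] := reach i j.
by elim: l => //= l ->; rewrite rotate_count.
Qed.

Lemma swap_odd_patterns t y :
  (swap_pattern y \in odd_patterns N t) = (y \in odd_patterns N t).
Proof. by rewrite !inE swapN. Qed.

(** A digit 1 of one rotated pair is a digit 1 of all [M >= 2] of them, so the
    gap is at least 2. If moreover the next gap falls short, then no odd
    pattern [y] differs from its colour exchange, since both would be mixed at
    the same pair, against [deficit_mixed]; hence [odd_patterns] has at most one
    element, the pattern that is mixed everywhere, and [deficit_gap] improves
    the bound to 3. *)
Lemma deficit_fixed t i : mixed_bit N t.+1 (Some i) = 1 ->
  digit t + (gap n N t.+2 < digit t.+1) + 1 <= gap n N t.+1.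
Proof.
move=> bit1.
have le_M : M + mixed_bit N t.+1 None <= \sum_(c : C) mixed_bit N t.+1 c.
  rewrite (bigD1 None) //= addnC leq_add2l.
  rewrite (reindex_omap Some id) => [|[j|]] //=.
  rewrite (eq_bigr (fun=> 1)) => [|j _]; last first.
    by rewrite -bit1 /mixed_bit (const_count j i).
  rewrite (eq_bigl xpredT) => [|j]; last by rewrite eqxx.
  by rewrite sum_nat_const card_ord muln1.
have le_gap : M <= gap n N t.+1.
  apply: leq_trans (gap_ge admN None t.+1).
  by move: le_M; rewrite (bigD1 None) //= addnC leq_add2l.
case: (ltnP (gap n N t.+2) (digit t.+1)) => [lt_gap | _]; last first.
  rewrite addn0 addn1; apply: leq_trans le_gap; apply: leq_ltn_trans M_gt1.
  by rewrite /digit; case: odd.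
have gap_eq0 : gap n N t.+2 = 0 by move: lt_gap; rewrite /digit; case: odd; case: gap.
have odd_n : odd (n %/ 2 ^ t.+1) by move: lt_gap; rewrite /digit; case: odd.
have := deficit_gap admN card_C_gt1 gap_eq0 odd_n.
suff le1 : #|odd_patterns N t.+1| <= 1.
  have : digit t <= 1 by rewrite /digit; case: odd.
  move: le_M; move: (\sum_c _) #|_| (gap _ _ _) le1 (digit t).
  by move=> a b d ? e ? ? ?; lia.
rewrite -(cards1 [ffun c : C => @None bool]).
apply: subset_leq_card; apply/subsetP=> y y_odd; rewrite inE.
have [c yc] := has_mixed card_C_odd (admissible_pattern admN (odd_pattern_gt0 y_odd)).
have [/eqP fixed_y | moved_y] := boolP (swap_pattern y == y).
  by apply/eqP/ffunP=> d; rewrite ffunE swap_fixed.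
have := deficit_mixed admN card_C_gt1 gap_eq0 c.
have : 2 <= #|[set y0 in odd_patterns N t.+1 | y0 c == None]|.
  rewrite -[2]/(true.+1) -moved_y -cards2; apply: subset_leq_card.
  apply/subsetP=> z; rewrite in_set2 => /orP[] /eqP->.
    by rewrite inE swap_odd_patterns y_odd swap_mixed yc.
  by rewrite inE y_odd yc.
by rewrite /mixed_bit; case: odd; lia.
Qed.

(** A nonzero count has a digit 1, and [deficit_fixed] turns it into a credit
    that [surplus] carries to the end, against minimality. *)
Lemma no_mixed i : column_count N (Some i) None = 0.
Proof.
apply/eqP; rewrite -leqn0 leqNgt; apply/negP => /odd_digit_exists[t odd_t].
have bit1 : mixed_bit N t (Some i) = 1 by rewrite /mixed_bit odd_t.
case: t bit1 odd_t => [|t] bit1 odd_t; first by rewrite (mixed_bit0 admN) in bit1.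
have lt_tn : t.+1 <= 2 * n.
  rewrite ltnNge; apply: contraL odd_t => le_nt; rewrite divn_small //.
  apply: leq_ltn_trans (ltn_expl t.+1 (ltnSn 1)); apply: leqW; apply: leq_trans le_nt.
  rewrite -(admissible_total admN) [X in _ <= X](bigID (fun y : pattern => y (Some i) == None)) /=.
  exact: leq_addr.
(* start [surplus] just after the index [t], with credit 1 *)
have := @surplus (gap n N) digit t.+1 1 (2 * n).
rewrite sum_gap => /(_ _ _ _ lt_tn) h.
suff : \sum_(t < 2 * n) digit t + (gap n N (2 * n).+1 < digit (2 * n)) + 1
   <= \sum_(t < 2 * n) digit t by move: (\sum_(_ < _) _) => a; lia.
apply: h => [u|u|].
- by rewrite /digit; case: odd.
- exact: deficit_compensated card_C_odd card_C_gt1.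
rewrite !big_ord_recr /= -!addnA; apply: leq_add.
  by apply: leq_trans (gap_surplus admN t card_C_odd card_C_gt1); apply: leq_addr.
by rewrite addnA (deficit_fixed bit1).
Qed.

Lemma support_Some y i : 0 < N y -> y (Some i) != None.
Proof.
move=> Ny; apply: contraTneq Ny => yi; rewrite -leqNgt -(no_mixed i).
by rewrite /column_count (bigD1 y) ?yi //= leq_addr.
Qed.

Lemma support_None y : 0 < N y -> y None = None.
Proof.
move=> Ny; have [[i|//] yi] := has_mixed card_C_odd (admissible_pattern admN Ny).
by have := support_Some i Ny; rewrite yi eqxx.
Qed.

Lemma count_None : column_count N None None = 2 * n.
Proof.
rewrite -(admissible_total admN) [RHS](bigID (fun y : pattern => y None == None)) /=.
rewrite [X in _ = _ + X]big1 ?addn0 // => y; apply: contraNeq; rewrite -lt0n.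
by move/support_None->.
Qed.

Lemma sum_mixed_bit t : \sum_(c : C) mixed_bit N t.+1 c = digit t.
Proof.
rewrite (bigD1 None) //= big1 ?addn0 => [|[i|] // _].
  by rewrite /mixed_bit count_None expnS divnMl.
by rewrite /mixed_bit no_mixed div0n.
Qed.

(** All gaps are at least the digits of [n] and their sums agree, so they are
    equal one by one. *)
Lemma floor_eq t : t < 2 * n ->
  \sum_(y : pattern) N y %/ 2 ^ t.+1 = 2 * (n %/ 2 ^ t.+1).
Proof.
move=> lt_tn.
have le_t (u : 'I_(2 * n)) : true -> digit u <= gap n N u.+1 ?= iff (digit u == gap n N u.+1).
  move=> _; split=> //; have := gapK admN None u.+1; rewrite sum_mixed_bit.
  have := floor_le admN (Some i0) u.+1; rewrite /mixed_bit no_mixed div0n addn0.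
  by move: (\sum_y _) (gap _ _ _) (digit u) => a b d; lia.
have [_] := leqif_sum le_t; rewrite sum_gap eqxx => /esym/forallP/(_ (Ordinal lt_tn))/eqP /= eq_t.
by have := gapK admN None t.+1; rewrite sum_mixed_bit eq_t addnC => /addIn.
Qed.

Lemma card_odd_patterns t : t < 2 * n -> #|odd_patterns N t| = 2 * digit t.
Proof.
move=> lt_tn; have := sum_floor_step N xpredT t.
have -> : [set y in odd_patterns N t | true] = odd_patterns N t.
  by apply/setP=> y; rewrite !inE andbT.
rewrite floor_eq //.
have -> : \sum_(y : pattern) N y %/ 2 ^ t = 2 * (n %/ 2 ^ t).
  case: t lt_tn => [|t] lt_tn; last by rewrite floor_eq // ltnW.
  rewrite expn0 divn1 -(admissible_total admN).
  by apply: eq_bigr => y _; rewrite divn1.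
by have := divn_pow2S n t; rewrite /digit; move: #|_| => a; lia.
Qed.

(** At a digit 1 of [N y] there are at most two odd patterns, and [y], its
    colour exchange and its rotation are among them. *)
Lemma rotate_or_swap y : 0 < N y ->
  rotate_pattern y = y \/ rotate_pattern y = swap_pattern y.
Proof.
move=> Ny; have [t odd_t] := odd_digit_exists Ny.
have lt_tn : t < 2 * n.
  rewrite ltnNge; apply: contraL odd_t => le_nt; rewrite divn_small //.
  by apply: leq_ltn_trans (leq_trans (count_le_total admN y) le_nt) (ltn_expl t _).
have y_odd : y \in odd_patterns N t by rewrite inE.
have swap_y : swap_pattern y != y.
  by apply: contraNneq (support_Some i0 Ny) => /swap_fixed->.
have card2 : #|odd_patterns N t| <= 2.
  by rewrite card_odd_patterns // /digit; case: odd.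
have eqA : odd_patterns N t = [set swap_pattern y; y].
  apply/esym/eqP; rewrite eqEcard cards2 swap_y card2 andbT.
  by apply/subsetP=> z /set2P[] ->; rewrite ?swap_odd_patterns.
have : rotate_pattern y \in odd_patterns N t by rewrite inE rotateN.
by rewrite eqA => /set2P[] ->; [right | left].
Qed.

(** A pattern invariant under rotation has one colour in all rotated pairs, and
    the last pair, being mixed, cannot balance it. *)
Lemma rotate_moves y : 0 < N y -> rotate_pattern y <> y.
Proof.
move=> Ny /ffunP rot_y.
have step i : y (Some (ordS i)) = y (Some i).
  by rewrite -[RHS]rot_y ffunE /=; case: (y _).
have const j : y (Some j) = y (Some i0).
  by have [l <-] := reach i0 j; elim: l => //= l <-.
have := admissible_pattern admN Ny.
have := support_Some i0 Ny; case y0 : (y (Some i0)) => [v|] // _ eq_card.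
have pos : 0 < #|[set c | y c == Some v]| by apply/card_gt0P; exists (Some i0); rewrite inE y0.
have zero : #|[set c | y c == Some (~~ v)]| = 0.
  apply/eqP; rewrite cards_eq0; apply/eqP/setP=> -[j|]; rewrite !inE ?support_None // const y0.
  by case: v {y0 pos}.
suff eq_v : #|[set c | y c == Some v]| = #|[set c | y c == Some (~~ v)]|.
  by rewrite eq_v zero in pos.
by case: (v); rewrite eq_card.
Qed.

(** Rotation exchanges the colours, so the colour of the first rotated pair
    determines all the others. *)
Lemma support_alternating y : 0 < N y -> y = alternating \/ y = swap_pattern alternating.
Proof.
move=> Ny; have [/(rotate_moves Ny)//|/ffunP rot_y] := rotate_or_swap Ny.
have step i : y (Some (ordS i)) = omap negb (y (Some i)).
  by have := rot_y (Some i); rewrite !ffunE /= => <-; case: (y _).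
have := support_Some i0 Ny; case y0 : (y (Some i0)) => [v|] // _.
have alt (j : 'I_M) : y (Some j) = Some (odd j (+) v).
  case: j => j; elim: j => [|j IH] lt_j.
    by rewrite -y0; congr (y (Some _)); apply/val_inj.
  have -> : Ordinal lt_j = ordS (Ordinal (ltnW lt_j)).
    by apply/val_inj; rewrite /= modn_small.
  by rewrite step IH /= modn_small //= addNb.
by case: v {y0} alt => alt; [right | left]; apply/ffunP=> -[j|]; rewrite !ffunE /= ?support_None ?alt
  ?addbT ?addbF.
Qed.

Lemma swap_alternating : swap_pattern alternating != alternating.
Proof. by apply/eqP=> /(swap_fixed (Some i0)); rewrite ffunE. Qed.

Lemma fixed_unique y :
  N y = if (y == alternating) || (y == swap_pattern alternating) then n else 0.
Proof.
have total : N alternating + N (swap_pattern alternating) = 2 * n.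
  rewrite -(admissible_total admN) [RHS](bigD1 alternating) //=; congr (_ + _).
  rewrite (bigD1 (swap_pattern alternating)) ?swap_alternating //= big1 ?addn0 // => z /andP[z1 z2].
  apply: contraTeq z1; rewrite -lt0n => /support_alternating[->|zE]; first by rewrite eqxx.
  by rewrite zE eqxx in z2.
have alt : N alternating = n by move: total; rewrite swapN; move: (N _) => a; lia.
have [->|yalt] := eqVneq y alternating; first by rewrite alt.
have [->|ysw] := eqVneq y (swap_pattern alternating); first by rewrite swapN.
apply/eqP; rewrite -leqn0 leqNgt; apply: contra yalt => /support_alternating[->//|yE].
by rewrite yE eqxx in ysw.
Qed.

End FixedMinimal.

Definition alternating_counts (y : pattern) : nat :=
  if (y == alternating) || (y == swap_pattern alternating) then n else 0.

Lemma sum_alternating (P : pred pattern) : \sum_(y | P y) alternating_counts y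
  = n * P alternating + n * P (swap_pattern alternating).
Proof.
rewrite big_mkcond (bigD1 alternating) //= (bigD1 (swap_pattern alternating)) ?swap_alternating //=.
rewrite big1 ?addn0 => [|y /andP[/negPf y1 /negPf y2]]; last first.
  by rewrite /alternating_counts y1 y2; case: ifP.
rewrite /alternating_counts !eqxx orbT /=.
by case: (P _); case: (P _); rewrite ?muln1 ?muln0.
Qed.

Lemma rotate_bij : bijective (omap (@ordS M)).
Proof.
by exists (omap (@ord_pred M)) => [[j|]|[j|]] //=; rewrite ?ordSK ?ord_predK.
Qed.

(** As [M] is even, the last and the first rotated pair also have different
    colours. *)
Lemma rotate_alternating : rotate_pattern alternating = swap_pattern alternating.
Proof.
apply/ffunP=> -[i|]; rewrite !ffunE //=.
by rewrite odd_mod //; apply: negbTE.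
Qed.

Lemma alternating_balanced :
  #|[set c | alternating c == Some true]| = #|[set c | alternating c == Some false]|.
Proof.
rewrite -[LHS](on_card_preimset (f := omap (@ordS M))); last exact/onW_bij/rotate_bij.
apply: eq_card => c; rewrite !inE; have /ffunP/(_ c) := rotate_alternating.
rewrite [LHS]ffunE [RHS]ffunE.
by case: (alternating _) (alternating c) => [[]|] [[]|].
Qed.

Lemma admissible_alternating : admissible n alternating_counts.
Proof.
apply/and3P; split.
- by rewrite sum_alternating !muln1 addnn mul2n.
- apply/forallP=> c; rewrite /column_count !sum_alternating !ffunE.
  by apply/eqP; case: c => [i|] //=; case: (odd i); rewrite addnC.
apply/forallP=> y; rewrite /alternating_counts; apply/implyP.
case: eqP => [-> _|_] /=; first by rewrite alternating_balanced.
case: eqP => [-> _|//].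
have swapE b : [set c | swap_pattern alternating c == Some b]
    = [set c | alternating c == Some (~~ b)].
  by apply/setP=> c; rewrite !inE [swap_pattern _ c]ffunE; case: b; case: (alternating c) => [[]|].
by rewrite !swapE alternating_balanced.
Qed.

Lemma logn_weight_alternating : logn 2 (weight n alternating_counts) = 2 * s2 n.
Proof.
have logn_bin : logn 2 'C(2 * n, n) = s2 n.
  apply/(@addIn (2 * logn 2 n`!)); rewrite logn_central_bin.
  rewrite (logn_fact_widen (leqnn _)) (@logn_fact_widen n (2 * n)) ?leq_pmull //.
  rewrite (@s2_widen n (2 * n)) ?leq_pmull // big_distrr -big_split /=.
  by apply: eq_bigr => t _; rewrite {1}expnS divnMl // [LHS]divn_pow2S addnC.
rewrite /weight (bigD1 None) //= [X in _ * (_ * X)]big1 ?muln1 => [|[i|] // _]; last first.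
  by rewrite /column_count sum_alternating !ffunE /= !muln0 bin0.
have -> : column_count alternating_counts None None = 2 * n.
  by rewrite /column_count sum_alternating !ffunE /= !muln1 addnn mul2n.
have -> : \prod_(y : pattern) (alternating_counts y)`! = n`! * n`!.
  rewrite (bigD1 alternating) //= (bigD1 (swap_pattern alternating)) ?swap_alternating //=.
  rewrite big1 ?muln1 => [|y /andP[/negPf y1 /negPf y2]]; last first.
    by rewrite /alternating_counts y1 y2.
  by rewrite /alternating_counts !eqxx orbT.
have -> : (2 * n)`! = 'C(2 * n, n) * (n`! * n`!).
  have := @bin_fact (2 * n) n; rewrite leq_pmull // => /(_ isT) <-.
  by rewrite mul2n -addnn addnK.
have half2n : (2 * n)./2 = n by rewrite mul2n doubleK.
rewrite mulnK ?muln_gt0 ?fact_gt0 // half2n lognM ?bin_gt0 ?leq_pmull //.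
by rewrite logn_bin addnn mul2n.
Qed.

End Fixed.

(** * The number of minimal multiplicities is odd *)

Lemma odd_divn_pow2 w a : 0 < w -> a <= logn 2 w -> odd (w %/ 2 ^ a) = (logn 2 w == a).
Proof.
move=> w_gt0 le_a; have [r co_r ->] := pfactor_coprime (isT : prime 2) w_gt0.
have odd_r : odd r by rewrite -coprime2n.
have r_gt0 : 0 < r by case: r odd_r {co_r}.
move: (logn 2 w) le_a => l le_a.
rewrite lognM ?expn_gt0 // pfactorK // logn_coprime // add0n.
rewrite -{1}(subnK le_a) expnD mulnA mulnK ?expn_gt0 // oddM odd_r oddX orbF /=.
by rewrite subn_eq0 eqn_leq le_a andbT.
Qed.

Lemma logn_odd_multiple a q : odd q -> logn 2 (2 ^ a * q) = a.
Proof.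
move=> odd_q; have q_gt0 : 0 < q by case: q odd_q.
by rewrite lognM ?expn_gt0 // pfactorK // logn_coprime ?coprime2n // addn0.
Qed.

Lemma odd_sum_card (T : finType) (P : pred T) (F : T -> nat) :
  odd (\sum_(x | P x) F x) = odd #|[set x | P x && odd (F x)]|.
Proof.
rewrite -sum1dep_card big_mkcondr /=.
apply: (big_ind2 (fun a b => odd a = odd b)) => // [a1 b1 a2 b2 e1 e2|x _].
  by rewrite !oddD e1 e2.
by case: odd.
Qed.

Section Parity.

Variable C : finType.
Variable n : nat.
Local Notation pattern := {ffun C -> option bool}.

Lemma eq_weight (N1 N2 : pattern -> nat) : N1 =1 N2 -> weight n N1 = weight n N2.
Proof.
move=> eqN; rewrite /weight; congr (_ %/ _ * _).
  by apply: eq_bigr => y _; rewrite eqN.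
by apply: eq_bigr => c _; rewrite !(eq_column_count _ _ eqN).
Qed.

Definition minimal_counts : {set {ffun pattern -> 'I_(2 * n).+1}} :=
  [set N | admissible n (counts N) && (logn 2 (weight n (counts N)) == 2 * s2 n)].

Lemma minimal_move (h : C -> C) (s : bool -> bool) :
  bijective h -> involutive s ->
  {in minimal_counts, forall N, move_counts h s N \in minimal_counts}.
Proof.
move=> h_bij s_inv N; rewrite !inE => /andP[admN minN].
rewrite (eq_admissible n (counts_move _ _ _)) admissible_move //=.
by rewrite (eq_weight (counts_move _ _ _)) weight_move.
Qed.

End Parity.

Lemma iter_move_rotate M n j (N : {ffun {ffun option 'I_M -> option bool} -> 'I_(2 * n).+1}) y :
  iter j (move_counts (omap (@ordS M)) id) N y
    = N [ffun c => y (omap (iter j (@ordS M)) c)].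
Proof.
elim: j y => [|j IH] y /=.
  by congr (N _); apply/ffunP=> -[i|]; rewrite ffunE.
rewrite ffunE IH; congr (N _); apply/ffunP=> c; rewrite !ffunE.
by case: c => [i|] /=; rewrite -?iterS ?iterSr; case: (y _).
Qed.

Lemma iter_rotate M n (N : {ffun {ffun option 'I_M -> option bool} -> 'I_(2 * n).+1}) :
  iter M (move_counts (omap (@ordS M)) id) N = N.
Proof.
apply/ffunP=> y; rewrite iter_move_rotate; congr (N _); apply/ffunP=> -[i|]; rewrite ffunE //=.
by congr (y (Some _)); apply/val_inj; rewrite val_iter_ordS modnDr modn_small.
Qed.

Lemma symmetric_minimal M n : 1 < M -> ~~ odd M ->
  [set N in [set N in minimal_counts (option 'I_M) n | move_counts id negb N == N]
    | move_counts (omap (@ordS M)) id N == N]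
  = [set [ffun y => inord (alternating_counts n y)]].
Proof.
move=> M_gt1 M_even.
set N0 := [ffun y => _] : {ffun _ -> 'I_(2 * n).+1}.
have N0E : counts N0 =1 @alternating_counts M n.
  move=> y; rewrite /counts ffunE inordK // ltnS /alternating_counts.
  by case: ifP => // _; rewrite leq_pmull.
apply/setP=> N; rewrite !inE; apply/idP/eqP => [|->].
  case/andP=> /andP[/andP[admN /eqP minN] /eqP swapN] /eqP rotN.
  apply/ffunP=> y; apply/val_inj; rewrite [RHS](N0E y).
  apply: (fixed_unique M_gt1 M_even admN _ _ minN) => z.
    by rewrite /counts -{2}swapN ffunE.
  by rewrite /counts -{2}rotN ffunE.
rewrite (eq_admissible n N0E) admissible_alternating //= (eq_weight n N0E).
rewrite logn_weight_alternating // eqxx /=.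
have fixed (h : option 'I_M -> option 'I_M) s : bijective h -> involutive s ->
    move_pattern h s (alternating M) = swap_pattern (alternating M) ->
    move_pattern h s (swap_pattern (alternating M)) = alternating M ->
    move_counts h s N0 == N0.
  move=> h_bij s_inv eq1 eq2; apply/eqP/ffunP=> y; rewrite !ffunE; congr inord.
  have inj := bij_inj (move_pattern_bij h_bij s_inv).
  have eqm a b : move_pattern h s a = b -> (move_pattern h s y == b) = (y == a).
    by move=> <-; rewrite (inj_eq inj).
  by rewrite /alternating_counts (eqm _ _ eq1) (eqm _ _ eq2) orbC.
have swapK : swap_pattern (swap_pattern (alternating M)) = alternating M.
  by apply/ffunP=> c; rewrite !ffunE; case: c => //= i; rewrite negbK.
apply/andP; split; apply: fixed => //; [by exists id | exact: negbK | exact: rotate_bij | | ].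
  exact: rotate_alternating.
rewrite -[RHS]swapK -[in RHS](rotate_alternating M_even).
by apply/ffunP=> c; rewrite !ffunE; case: c.
Qed.

Theorem theorem2 (m n : nat) (hm : 0 < m) (hn : 0 < n)
    (hk : exists k : nat, 0 < k /\ m = 2 ^ k + 1) :
  logn 2 (B m n) = 2 * s2 n.
Proof.
have [k [k_gt0 mE]] := hk; set M := 2 ^ k.
have M_gt1 : 1 < M by rewrite -[1](expn0 2) ltn_exp2l.
have M_even : ~~ odd M by rewrite oddX orbF -lt0n.
pose C := option 'I_M; pose pattern := {ffun C -> option bool}.
have C_odd : odd #|{: C}| := card_C_odd M_even.
have C_gt1 : 1 < #|{: C}| := card_C_gt1 M_gt1.
rewrite (@card_balanced C) ?card_option ?card_ord ?mE ?addn1 // card_balanced_grid.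
pose q (N : {ffun pattern -> 'I_(2 * n).+1}) := weight n (counts N) %/ 2 ^ (2 * s2 n).
rewrite (eq_bigr (fun N => 2 ^ (2 * s2 n) * q N)) => [|N admN]; last first.
  rewrite mulnC divnK // pfactor_dvdn //; first exact: logn_weight_ge.
  exact: weight_gt0.
rewrite -big_distrr; apply: logn_odd_multiple; rewrite /= odd_sum_card.
have -> : [set N | admissible n (counts N) && odd (q N)] = minimal_counts C n.
  apply/setP=> N; rewrite !inE; apply: andb_id2l => admN.
  by apply: odd_divn_pow2; [apply: weight_gt0 | apply: logn_weight_ge].
rewrite (@odd_card_fixed _ (move_counts id negb) 1); last 2 first.
- apply: minimal_move; [by exists id | exact: negbK].
- by move=> N _; apply/ffunP=> y; rewrite !ffunE; congr (N _); apply/ffunP=> c;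
    rewrite !ffunE; case: (y c) => [[]|].
rewrite (@odd_card_fixed _ (move_counts (omap (@ordS M)) id) k); last 2 first.
- move=> N /setIdP[minN /eqP swapN]; apply/setIdP; split.
    exact: minimal_move (rotate_bij M) (fun _ => erefl) _ minN.
  apply/eqP; rewrite -{2}swapN; apply/ffunP=> y; rewrite !ffunE; congr (N _).
  by apply/ffunP=> c; rewrite !ffunE /=; case: (y _).
- move=> N _; exact: iter_rotate.
by rewrite symmetric_minimal // cards1.
Qed.
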